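(* For integers $n,i,j,k,l\ge 0$, let $P_6(n;i,j,k,l)$ denote the number of partitions of $n$ into $i$ distinct parts in color $\mathbb{A}$, $j$ distinct parts in color $\mathbb{B}$, $k$ distinct parts in color $\mathbb{C}$, and $l$ distinct parts in color $\mathbb{D}$. For nonnegative integers $a,b,c,d,ab,ac,ad,bc,bd,cd,Q$, let $\tilde G_6(n;a,b,c,d,ab,ac,ad,bc,bd,cd,Q)$ denote the number of Type-1 partitions $\pi$ of $n$ such that $$\nu_{\mathbb{A}}(\pi)=a,\ \nu_{\mathbb{B}}(\pi)=b,\ \nu_{\mathbb{C}}(\pi)=c,\ \nu_{\mathbb{D}}(\pi)=d,$$ $$\nu_{\mathbb{AB}}(\pi)=ab,\ \nu_{\mathbb{AC}}(\pi)=ac,\ \nu_{\mathbb{AD}}(\pi)=ad,\ \nu_{\mathbb{BC}}(\pi)=bc,\ \nu_{\mathbb{BD}}(\pi)=bd,\ \nu_{\mathbb{CD}}(\pi)=cd,$$ and $\nu_{\mathbb{ABCD}}(\pi)=Q$, where $\nu_{X}(\pi)$ denotes the number of parts of $\pi$ in color $X$. Let $$G_6(n;i,j,k,l)=\sum \tilde G_6(n;a,b,c,d,ab,ac,ad,bc,bd,cd,Q),$$ where the sum is over all nonnegative integers $a,b,c,d,ab,ac,ad,bc,bd,cd,Q$ satisfying $$\begin{cases} i=a+ab+ac+ad+Q,\\ j=b+ab+bc+bd+Q,\\ k=c+ac+bc+cd+Q,\\ l=d+ad+bd+cd+Q.\end{cases}$$ Then $$G_6(n;i,j,k,l)=P_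6(n;i,j,k,l).$$
   Context: The symbols $ab,ac,ad,bc,bd,cd$ are names of independent nonnegative integer parameters, not products. Colored integers: all positive integers occur in the four primary colors $\mathbb{A},\mathbb{B},\mathbb{C},\mathbb{D}$; integers $\ge 2$ occur also in the six secondary colors $\mathbb{AB},\mathbb{AC},\mathbb{AD},\mathbb{BC},\mathbb{BD},\mathbb{CD}$; integers $\ge 4$ occur also in the quaternary color $\mathbb{ABCD}$. The integer $n$ in color $X$ is written $X_n$ (e.g. $\mathbb{A}_n$, $\mathbb{CD}_n$, $\mathbb{ABCD}_n$). No other colors (in particular no ternary colors) are used. A partition of $n$ into colored integers is a finite multiset of colored integers whose underlying (uncolored) integers sum to $n$. In the definition of $P_6$, parts of the same color are required to be distinct integers; the same integer may occur in different colors. Ordering of colored integers: if $m<n$ as ordinary integers, then $m$ in any color is less than $n$ in any color; if the same integer $n$ occurs in two different colors, the order is $$\mathbb{ABCD}_n<\mathbb{AB}_n<\mathbb{AC}_n<\mathbb{AD}_n<\mathbb{A}_n<\mathbb{BC}_n<\mathbb{BD}_n<\mathbb{B}_n<\mathbb{CD}_n<\mathbb{C}_n<\mathbb{D}_n .$$ A color is of higher order than another if it appears to the right of the other in this list. Type-1 partitions: a partition $\pi: m_1+m_2+\dots+m_\nu$ into colored integers, written with the largest part first (parts with larger underlying integer come first and, among parts with the same underlying integer $n$, parts are listed in decreasing order with respect to $\mathbb{ABCD}_n<\mathbb{AB}_n<\mathbb{AC}_n<\mathbb{AD}_n<\mathbb{A}_n<\mathbb{BC}_n<\mathbb{BD}_n<\mathbb{B}_n<\mathbb{CD}_n<\mathbb{C}_n<\mathbb{D}_n$),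 is of Type-1 if all the following hold, where gaps are differences of the underlying uncolored integers. (1) Parts in the non-quaternary (i.e. primary and secondary) colors differ by $\ge 1$; that is, consecutive ones, when the non-quaternary parts are listed in order, have gap at least $1$. The gap may equal $1$ if and only if the two parts are of the same primary color, or the larger part is in a color of higher order than that of the smaller part. (2) The gap between the parts in quaternary color is $\ge 4$. (3) The least quaternary part (if there is one), as an uncolored integer, is $$\begin{cases}\ge 3+2\tau, & \text{if } \mathbb{A}_1 \text{ is a part of } \pi,\\ \ge 4+2\tau, & \text{otherwise},\end{cases}$$ where $\tau$ is the number of non-quaternary parts of $\pi$. There is no gap condition between quaternary and non-quaternary parts. *)

(* Defs.v *)
From HB Require Import structures.
From mathcomp Require Import all_boot.

Set Implicit Arguments.
Unset Strict Implicit.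
Unset Printing Implicit Defensive.

(* The constructors are listed from lowest to highest order. *)
Inductive color :=
  cABCD | cAB | cAC | cAD | cA | cBC | cBD | cB | cCD | cC | cD.

Definition color_order (X : color) : nat :=
  match X with
  | cABCD => 0 | cAB => 1 | cAC => 2 | cAD => 3 | cA => 4 | cBC => 5
  | cBD => 6 | cB => 7 | cCD => 8 | cC => 9 | cD => 10
  end.

Definition all_colors : seq color :=
  [:: cABCD; cAB; cAC; cAD; cA; cBC; cBD; cB; cCD; cC; cD].

Lemma color_orderK :
  pcancel color_order (fun r => nth None (map Some all_colors) r).
Proof. by case. Qed.

HB.instance Definition _ := Countable.copy color (pcan_type color_orderK).

Lemma all_colorsP : Finite.axiom all_colors.
Proof. by case. Qed.

HB.instance Definition _ := isFinite.Build color all_colorsP.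

Definition is_primary (X : color) : bool := X \in [:: cA; cB; cC; cD].

Definition is_quaternary (X : color) : bool := X == cABCD.

Definition least_integer (X : color) : nat :=
  if is_quaternary X then 4 else if is_primary X then 1 else 2.

(* [(m, X)] is the integer [m] in color [X]. *)
Definition cint : Type := (nat * color)%type.

Definition valid_cint (x : cint) : bool := least_integer x.2 <= x.1.

Definition geq_cint (x y : cint) : bool :=
  (y.1 < x.1) || ((x.1 == y.1) && (color_order y.2 <= color_order x.2)).

(* A finite multiset of colored integers is represented by the unique list of
   its elements in weakly decreasing order. *)
Definition is_partition (n : nat) (p : seq cint) : bool :=
  [&& all valid_cint p, sorted geq_cint p & sumn (map fst p) == n].

Definition nu (X : color) (p : seq cint) : nat := count (fun x => x.2 == X) p.

(* A partition of [n] has at most [n] parts, each of size at most [n], so the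
   partitions of [n] can be counted inside a finite type of bounded lists;
   [num_partitions_size] below shows that the bounds lose nothing. *)
Definition unbound (n : nat) (q : seq ('I_n.+1 * color)) : seq cint :=
  [seq (val x.1, x.2) | x <- q].

Definition num_partitions (n : nat) (P : pred (seq cint)) : nat :=
  #|[set q : {bseq n of 'I_n.+1 * color}
       | is_partition n (unbound q) && P (unbound q)]|.

Lemma unbound_inj n : injective (@unbound n).
Proof. by apply: inj_map => -[x X] [y Y] [] /val_inj -> ->. Qed.

Lemma unbound_onto n p : is_partition n p ->
  exists q : {bseq n of 'I_n.+1 * color}, unbound q = p.
Proof.
case/and3P => vp _ /eqP sp.
have gt0 X : 0 < least_integer X by case: X.
have szp : size p <= n.
  rewrite -sp; elim: p vp {sp} => //= x p IH /andP[vx /IH].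
  exact: leq_add (leq_trans (gt0 _) vx).
have lep x : x \in p -> x.1 < n.+1.
  rewrite ltnS -sp; elim: p {vp sp szp} => //= y p IH.
  rewrite inE => /predU1P[->|/IH le]; first exact: leq_addr.
  exact: leq_trans le (leq_addl _ _).
have szq : size [seq (inord x.1 : 'I_n.+1, x.2) | x <- p] <= n.
  by rewrite size_map.
exists (Bseq szq); rewrite /unbound /= -map_comp -[RHS]map_id.
by apply/eq_in_map => -[m X] /lep /= ltm; rewrite inordK.
Qed.

Lemma num_partitions_size n (P : pred (seq cint)) (s : seq (seq cint)) :
  uniq s -> (forall p, (p \in s) = is_partition n p && P p) ->
  num_partitions n P = size s.
Proof.
move=> us sP; rewrite /num_partitions cardE.
rewrite -(size_map (fun q : {bseq n of _} => unbound q)).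
apply/perm_size/uniq_perm => //.
  rewrite map_inj_uniq ?enum_uniq // => q1 q2 /unbound_inj; exact: val_inj.
move=> p; rewrite sP; apply/mapP/idP => [[q]|Hp].
  by rewrite mem_enum inE => Hq ->.
have /andP[/unbound_onto[q defp] _] := Hp.
by exists q; rewrite // mem_enum inE defp.
Qed.

Definition non_quaternary_parts (p : seq cint) : seq cint :=
  [seq x <- p | ~~ is_quaternary x.2].

Definition quaternary_parts (p : seq cint) : seq cint :=
  [seq x <- p | is_quaternary x.2].

(* In the two gap relations [x] is the larger and [y] the smaller part. *)
Definition non_quaternary_gap (x y : cint) : bool :=
  (y.1 + 1 <= x.1) &&
  ((x.1 == y.1 + 1) ==>
     (is_primary x.2 && (x.2 == y.2)) || (color_order y.2 < color_order x.2)).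

Definition quaternary_gap (x y : cint) : bool := y.1 + 4 <= x.1.

(* Parts are listed in decreasing order, so the least quaternary part is the
   last entry of [quaternary_parts p]. *)
Definition least_quaternary_bound (p : seq cint) : bool :=
  let tau := size (non_quaternary_parts p) in
  if quaternary_parts p is x :: s then
    (if (1, cA) \in p then 3 + 2 * tau else 4 + 2 * tau) <= (last x s).1
  else true.

Definition type1 (p : seq cint) : bool :=
  [&& sorted non_quaternary_gap (non_quaternary_parts p),
      sorted quaternary_gap (quaternary_parts p)
    & least_quaternary_bound p].

Definition P6 (n i j k l : nat) : nat :=
  num_partitions n (fun p =>
    [&& all (fun x => is_primary x.2) p, uniq p,
        nu cA p == i, nu cB p == j, nu cC p == k & nu cD p == l]).

(* The eleven parameters of the refined count are packaged as the function [m]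
   giving the prescribed number of parts in each color. *)
Definition G6_tilde (n : nat) (m : color -> nat) : nat :=
  num_partitions n (fun p => type1 p && [forall X, nu X p == m X]).

(* The four constraints force every value of [m] to be at most [i + j + k + l],
   so the bound on the codomain of [m] excludes no solution. *)
Definition G6 (n i j k l : nat) : nat :=
  \sum_(m : {ffun color -> 'I_(i + j + k + l).+1} |
        [&& i == m cA + m cAB + m cAC + m cAD + m cABCD,
            j == m cB + m cAB + m cBC + m cBD + m cABCD,
            k == m cC + m cAC + m cBC + m cCD + m cABCD
          & l == m cD + m cAD + m cBD + m cCD + m cABCD])
    G6_tilde n (fun X => m X).

(* Main.v *)
From HB Require Import structures.
Require Import Defs.
From mathcomp Require Import all_boot all_algebra.
From mathcomp Require Import ring zify.

(** Work over a commutative ring in which [q ^ (N + 1) = 0], so that products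
    in [q] are finite. Reading the non-quaternary parts from the smallest one
    upwards, the gap conditions are a linear recurrence for the generating
    functions of the chains with parts [>= X_n]. It is solved by
    [Phi_n (p_X(t) h(t))], where [Phi_n] is the linear functional sending [t^k]
    to [q^(k(k-1)/2 + nk)], each [p_X] is an explicit polynomial, and
    [h(t) = prod_(m >= 0, X < Y) (1 + XY q^(m+1) t) / prod_(m, X) (1 - X q^m t)].
    Summing over the quaternary parts multiplies the integrand by an Euler
    product in [ABCD t^2] (two slightly different ones, according to whether
    [A_1] is a part), so the Type-1 generating function is [Phi_1] of an explicit
    series [S(A,B,C,D)]. Two facts finish the proof. First,
    [S(A,B,C,D) - (1+Aq) S(Aq,B,C,D) = t R(t) - q R(qt)] for an explicit [R],
    and [Phi_1] kills the right-hand side; iterating, [A] contributes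
    [prod_n (1 + A q^n)] and is replaced by [0]. Second,
    [S(0,B,C,D) = S(B,C,D,0)], so the other three letters follow in turn. *)

Set Implicit Arguments.
Unset Strict Implicit.
Unset Printing Implicit Defensive.

(** * Enumeration of chains *)

Section Chains.

Context (v : pred nat) (g : nat -> nat) (g_gt0 : forall i, 0 < g i).

(** [m] is fuel: it drops by one while the position may jump by [g i]. Every chain from [i] with
    entries below [i + m] is listed, possibly with others that reach further. *)
Fixpoint chains m i : seq (seq nat) :=
  if m is m'.+1 then
    chains m' i.+1 ++
    (if v i then [seq i :: s | s <- chains m' (i + g i)] else [::])
  else [:: [::]].

Lemma chainsS m i : chains m.+1 i = chains m i.+1 ++
  (if v i then [seq i :: s | s <- chains m (i + g i)] else [::]).
Proof. by []. Qed.

Fixpoint is_chain i s :=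
  if s is j :: s' then [&& i <= j, v j & is_chain (j + g j) s'] else true.

Lemma is_chain_leq i i' s : i' <= i -> is_chain i s -> is_chain i' s.
Proof. by case: s => //= j s le_i /and3P[/(leq_trans le_i)-> -> ->]. Qed.

Lemma mem_is_chain i s j : is_chain i s -> j \in s -> i <= j.
Proof.
elim: s i => //= k s IH i /and3P[le_ik _ /IH{}IH].
by rewrite inE => /predU1P[->//|/IH]; lia.
Qed.

Lemma chains_is_chain m i s : s \in chains m i -> is_chain i s.
Proof.
elim: m i s => [|m IH] i s /=; first by rewrite inE => /eqP->.
rewrite mem_cat => /orP[/IH/is_chain_leq->//|].
by case: ifP => // vi /mapP[s' /IH ch ->] /=; rewrite leqnn vi.
Qed.

Lemma mem_chains m i s :
  is_chain i s -> all (fun j => j < i + m) s -> s \in chains m i.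
Proof.
elim: m i s => [|m IH] i [|j s] //=; first by rewrite addn0; lia.
  by move=> *; rewrite mem_cat IH.
case/and3P=> le_ij vj ch /andP[lt_j all_s]; rewrite mem_cat.
case: (ltngtP i j) le_ij => // [lt_ij|eq_ij] _.
  rewrite IH //=; first by rewrite lt_ij vj.
  by rewrite addSnnS lt_j.
rewrite -eq_ij in vj ch *; rewrite vj map_f ?orbT // IH //.
by apply: sub_all all_s => k; have := g_gt0 i; lia.
Qed.

Lemma chains_uniq m i : uniq (chains m i).
Proof.
elim: m i => //= m IH i; rewrite cat_uniq IH /=.
case: ifP => //= _; rewrite map_inj_uniq ?IH ?andbT; last by move=> s s' [].
apply/hasPn => _ /mapP[s _ ->]; apply/negP => /chains_is_chain /=.
by rewrite ltnn.
Qed.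

End Chains.

Arguments chains : simpl never.

(* The colored integer [X_n] is encoded as [11 n + color_order X], which turns
   [geq_cint] into [>=] on [nat] and each gap condition into a minimal step. *)
Definition part (i : nat) : cint :=
  (i %/ 11, nth cABCD all_colors (i %% 11)).
Definition pos (x : cint) : nat := (x.1 * 11 + color_order x.2).

Lemma partE n r : r < 11 -> part (n * 11 + r) = (n, nth cABCD all_colors r).
Proof.
move=> lt_r; rewrite /part divnMDl // modnMDl divn_small // modn_small //.
by rewrite addn0.
Qed.

Lemma color_order_lt X : color_order X < 11.
Proof. by case: X. Qed.

Lemma posK : cancel pos part.
Proof. by case=> n X; rewrite partE ?color_order_lt //; case: X. Qed.

Lemma partK : cancel part pos.
Proof.
move=> i; rewrite /pos /part [RHS](divn_eq i 11) /=; congr (_ + _).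
move: (i %% 11) (ltn_pmod i (isT : 0 < 11)) => r.
by do 11?[case: r => [|r] //].
Qed.

Definition chain_valid i : bool :=
  ((part i).2 != cABCD) && (least_integer (part i).2 <= (part i).1).
(** Adding 11 reaches the same color at the next integer, which only primary colors may repeat; 12
    demands a color of higher order there. *)
Definition chain_step i : nat := if is_primary (part i).2 then 11 else 12.

Lemma chain_step_gt0 i : 0 < chain_step i.
Proof. by rewrite /chain_step; case: ifP. Qed.

(* [15] is the position of [A_1]. *)
Definition quaternary_bound (s : seq nat) : nat :=
  if 15 \in s then 3 + 2 * size s else 4 + 2 * size s.

(** * Type-1 partitions as pairs of chains *)

Definition quaternary (m : nat) : cint := (m, cABCD).

Definition merge_parts (s r : seq nat) : seq cint :=
  sort geq_cint (map part s ++ map quaternary r).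

Definition chain_of (p : seq cint) := map pos (rev (non_quaternary_parts p)).
Definition quaternaries_of (p : seq cint) :=
  map (fun x : cint => x.1) (rev (quaternary_parts p)).

Lemma geq_cintE x y : geq_cint x y = (pos y <= pos x).
Proof.
case: x y => [m X] [n Y]; rewrite /geq_cint /pos /=.
by case: X; case: Y; rewrite /=; lia.
Qed.

Lemma geq_cint_total : total geq_cint.
Proof. by move=> x y; rewrite !geq_cintE leq_total. Qed.

Lemma geq_cint_trans : transitive geq_cint.
Proof. by move=> y x z; rewrite !geq_cintE => ? /leq_trans->. Qed.

Lemma geq_cint_anti : antisymmetric geq_cint.
Proof.
by move=> x y; rewrite !geq_cintE -eqn_leq => /eqP /(can_inj posK).
Qed.

(** The default [i] of [head] makes the start condition vacuous on the empty chain. *)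
Lemma is_chainE v g i s : is_chain v g i s =
  [&& i <= head i s, all v s & sorted (fun a b => a + g a <= b) s].
Proof.
elim: s i => [|j s IH] i /=; first by rewrite leqnn.
rewrite IH; case: s {IH} => [|k s] /=; first by rewrite leqnn !andbT.
rewrite -!andbA; congr [&& _, _ & _]; rewrite andbCA; congr (_ && _).
by rewrite andbCA.
Qed.

Lemma rev_sorted_map (T : Type) (f : T -> nat) (g : nat -> nat) p :
  sorted (fun a b => a + g a <= b) (map f (rev p)) =
  sorted (fun x y => f y + g (f y) <= f x) p.
Proof. by rewrite sorted_map rev_sorted. Qed.

Lemma non_quaternary_gapE x y : ~~ is_quaternary x.2 -> ~~ is_quaternary y.2 ->
  non_quaternary_gap x y = (pos y + chain_step (pos y) <= pos x).
Proof.
rewrite /chain_step posK /pos; case: x y => [m X] [n Y] /=.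
by case: X => //; case: Y => //= _ _; rewrite /non_quaternary_gap /=; lia.
Qed.

Lemma chain_valid_pos x :
  chain_valid (pos x) = ~~ is_quaternary x.2 && valid_cint x.
Proof. by rewrite /chain_valid posK. Qed.

(** The integer 1 occurs only in primary colors, the lowest of which is [cA]; hence chains may start
    at 15. *)
Lemma pos_valid x : chain_valid (pos x) -> 15 <= pos x.
Proof.
rewrite chain_valid_pos /valid_cint /pos; case: x => m X.
by case: X => //; rewrite /least_integer /=; lia.
Qed.

Lemma sorted_geq_chain v g i s : (forall i, 0 < g i) ->
  is_chain v g i s -> sorted ltn s.
Proof.
move=> g0; rewrite is_chainE => /and3P[_ _]; apply: sub_sorted => a b.
by have := g0 a; lia.
Qed.

Lemma chain_of_is_chain p : all valid_cint p ->
  is_chain chain_valid chain_step 15 (chain_of p) =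
  sorted non_quaternary_gap (non_quaternary_parts p).
Proof.
move=> valid_p; rewrite is_chainE /chain_of rev_sorted_map.
have nq_p : all (fun x => ~~ is_quaternary x.2) (non_quaternary_parts p).
  exact: filter_all.
have val_s : all chain_valid (map pos (rev (non_quaternary_parts p))).
  rewrite all_map all_rev; apply/allP => x.
  rewrite mem_filter /= => /andP[qx px].
  by rewrite chain_valid_pos qx (allP valid_p).
rewrite val_s /=.
have -> : 15 <= head 15 (map pos (rev (non_quaternary_parts p))).
  by case: (rev _) val_s => //= x l /andP[/pos_valid].
symmetry; move: nq_p; apply: eq_in_sorted => x y.
exact: non_quaternary_gapE.
Qed.

(** Reversal turns the last quaternary part into a head; the default [b] settles the case without
    quaternary parts. *)
Lemma least_quaternary_boundE p : least_quaternary_bound p =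
  let b := quaternary_bound (chain_of p) in b <= head b (quaternaries_of p).
Proof.
have mem15 : (15 \in chain_of p) = ((1, cA) \in p).
  rewrite -[15]/(pos (1, cA)) mem_map; last exact: can_inj posK.
  by rewrite mem_rev mem_filter.
rewrite /least_quaternary_bound /quaternary_bound mem15 size_map size_rev.
rewrite /quaternaries_of; case: (quaternary_parts p) => [|x l] /=.
  by rewrite leqnn.
by rewrite lastI rev_rcons.
Qed.

Lemma type1E p : all valid_cint p -> type1 p =
  is_chain chain_valid chain_step 15 (chain_of p) &&
  is_chain xpredT (fun=> 4) (quaternary_bound (chain_of p)) (quaternaries_of p).
Proof.
move=> valid_p; rewrite chain_of_is_chain // is_chainE all_predT /=.
rewrite /type1 least_quaternary_boundE rev_sorted_map /=.
by congr (_ && _); rewrite andbC.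
Qed.

Lemma merge_partsK p : sorted geq_cint p ->
  merge_parts (chain_of p) (quaternaries_of p) = p.
Proof.
move=> sorted_p; rewrite /merge_parts /chain_of /quaternaries_of -!map_comp.
rewrite (eq_map (g := id) posK) map_id.
rewrite [X in _ ++ X](_ : _ = rev (quaternary_parts p)); last first.
  rewrite -[RHS]map_id; apply/eq_in_map => -[m X].
  by rewrite mem_rev mem_filter => /andP[/eqP /= -> _].
apply: (sorted_eq geq_cint_trans geq_cint_anti) => //.
  exact/sort_sorted/geq_cint_total.
rewrite perm_sort -rev_cat perm_rev.
apply/permPl; exact: (perm_filterC (fun x => is_quaternary x.2)).
Qed.

Lemma filter_merge_parts (a : pred color) s r :
  [seq x <- merge_parts s r | a x.2] =
  sort geq_cint ([seq x <- map part s | a x.2] ++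
    (if a cABCD then map quaternary r else [::])).
Proof.
rewrite /merge_parts (filter_sort geq_cint_total geq_cint_trans) filter_cat.
rewrite [X in _ ++ X](_ : _ = if a cABCD then map quaternary r else [::]) //.
by elim: r => [|m r /= ->]; case: (a cABCD).
Qed.

Lemma sort_rev_geq (T : Type) (f : T -> cint) s :
  sorted (fun a b => pos (f a) < pos (f b)) s ->
  sort geq_cint (map f s) = rev (map f s).
Proof.
move=> sorted_s; apply: (sorted_eq geq_cint_trans geq_cint_anti).
- exact/sort_sorted/geq_cint_total.
- rewrite rev_sorted sorted_map; apply: sub_sorted sorted_s => a b.
  by rewrite /= geq_cintE => /ltnW.
by rewrite perm_sort perm_sym perm_rev.
Qed.

Lemma chain_of_merge s r : all chain_valid s -> sorted ltn s ->
  chain_of (merge_parts s r) = s.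
Proof.
move=> val_s sorted_s; rewrite /chain_of /non_quaternary_parts.
rewrite (filter_merge_parts (fun X => ~~ is_quaternary X)) /= cats0.
rewrite (all_filterP _); last first.
  by rewrite all_map; apply: sub_all val_s => i /andP[].
rewrite sort_rev_geq ?revK; last first.
  by apply: sub_sorted sorted_s => a b; rewrite !partK.
by rewrite -map_comp -[RHS]map_id; apply: eq_map => i /=; rewrite partK.
Qed.

Lemma quaternaries_of_merge s r : all chain_valid s -> sorted ltn r ->
  quaternaries_of (merge_parts s r) = r.
Proof.
move=> val_s sorted_r; rewrite /quaternaries_of /quaternary_parts.
rewrite (filter_merge_parts is_quaternary) /=.
rewrite [X in X ++ _](_ : _ = [::]); last first.
  elim: s val_s => //= i s IH /andP[/andP[/negbTE ni _] /IH ->].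
  by rewrite /is_quaternary ni.
rewrite cat0s sort_rev_geq ?revK; last first.
  by apply: sub_sorted sorted_r => a b; rewrite /pos /=; lia.
by rewrite -map_comp map_id.
Qed.

Lemma merge_parts_valid s r : all chain_valid s -> all (leq 4) r ->
  all valid_cint (merge_parts s r).
Proof.
move=> val_s val_r; rewrite /merge_parts all_sort all_cat !all_map.
apply/andP; split; last exact: val_r.
by apply: sub_all val_s => i /andP[].
Qed.

Definition type1_list m1 m2 : seq (seq cint) :=
  [seq merge_parts s r | s <- chains chain_valid chain_step m1 15,
     r <- chains xpredT (fun=> 4) m2 (quaternary_bound s)].

(** Makes the quaternary parts valid without a separate condition. If [A_1] occurs, the chain is
    nonempty and the bound is at least 5. *)
Lemma quaternary_bound_ge4 s : 4 <= quaternary_bound s.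
Proof.
rewrite /quaternary_bound; case: ifP => [|_]; last by lia.
by case: s => //= i s _; lia.
Qed.

Lemma mem_type1_list_is m1 m2 s r :
  s \in chains chain_valid chain_step m1 15 ->
  r \in chains xpredT (fun=> 4) m2 (quaternary_bound s) ->
  [/\ all chain_valid s, sorted ltn s, all (leq 4) r & sorted ltn r].
Proof.
move=> /chains_is_chain chs /chains_is_chain chr.
split.
- by move: chs; rewrite is_chainE => /and3P[].
- exact: (sorted_geq_chain chain_step_gt0 chs).
- apply/allP => j /(mem_is_chain chr); apply: leq_trans.
  exact: quaternary_bound_ge4.
- exact: (@sorted_geq_chain _ (fun=> 4) _ _ (fun=> isT) chr).
Qed.

Lemma type1_list_uniq m1 m2 : uniq (type1_list m1 m2).
Proof.
apply: allpairs_uniq_dep => [||p p']; first exact: chains_uniq.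
  by move=> s _; apply: chains_uniq.
case/allpairsPdep => s [r [s_in r_in ->]].
case/allpairsPdep => s' [r' [s_in' r_in' ->]] /= E.
have [vs ss _ sr] := mem_type1_list_is s_in r_in.
have [vs' ss' _ sr'] := mem_type1_list_is s_in' r_in'.
have := congr1 chain_of E; rewrite !chain_of_merge // => ->.
by have := congr1 quaternaries_of E; rewrite !quaternaries_of_merge // => ->.
Qed.

Lemma mem_type1_list N m1 m2 n p :
  n <= N -> 11 * N.+2 <= m1 -> 11 * N.+2 <= m2 ->
  is_partition n p -> (p \in type1_list m1 m2) = type1 p.
Proof.
move=> le_n le_m1 le_m2 /and3P[valid_p sorted_p /eqP sum_p].
have small x : x \in p -> x.1 <= N.
  move=> px; apply: leq_trans le_n; rewrite -sum_p sumnE big_map.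
  by rewrite (big_rem x) //= leq_addr.
rewrite type1E //.
apply/allpairsPdep/andP => [[s [r [s_in r_in ->]]]|[chs chr]].
  have [vs ss _ sr] := mem_type1_list_is s_in r_in.
  rewrite chain_of_merge // quaternaries_of_merge //.
  by split; [apply: chains_is_chain s_in|apply: chains_is_chain r_in].
exists (chain_of p), (quaternaries_of p); split; last by rewrite merge_partsK.
  apply: mem_chains => //; first exact: chain_step_gt0.
  apply/allP => _ /mapP[x + ->]; rewrite mem_rev mem_filter => /andP[_ /small].
  by have := color_order_lt x.2; rewrite /pos /=; lia.
apply: mem_chains => //; apply/allP => _ /mapP[x + ->].
by rewrite mem_rev mem_filter => /andP[_ /small] /=; lia.
Qed.

Lemma type1_list_partition m1 m2 p : p \in type1_list m1 m2 ->
  all valid_cint p && sorted geq_cint p.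
Proof.
case/allpairsPdep => s [r [s_in r_in ->]].
have [vs _ vr _] := mem_type1_list_is s_in r_in.
by rewrite merge_parts_valid //=; apply/sort_sorted/geq_cint_total.
Qed.

(** * Partitions into distinct primary parts *)

Definition primary_list N : seq (seq cint) :=
  [seq map part (rev s) |
     s <- chains (fun i => is_primary (part i).2) (fun=> 1) (N.+1 * 11) 11].

Lemma primary_list_uniq N : uniq (primary_list N).
Proof.
rewrite map_inj_uniq ?chains_uniq // => s s'.
by move/(inj_map (can_inj partK))/(can_inj (@revK _)).
Qed.

Lemma part_sorted_geq s : sorted ltn s -> sorted geq_cint (map part (rev s)).
Proof.
rewrite map_rev rev_sorted sorted_map; apply: sub_sorted => i j /ltnW.
by rewrite /= geq_cintE !partK.
Qed.

Lemma primary_list_partition N p : p \in primary_list N ->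
  all valid_cint p && sorted geq_cint p.
Proof.
case/mapP => s /chains_is_chain chs ->; rewrite part_sorted_geq ?andbT.
  rewrite all_map all_rev; apply/allP => i s_i.
  move: chs (mem_is_chain chs s_i).
  rewrite is_chainE => /and3P[_ /allP/(_ i s_i) pr _].
  rewrite /= /valid_cint /least_integer pr.
  by case: ifP => [/eqP E|_]; rewrite ?E // in pr *; rewrite /part /=; lia.
exact: (@sorted_geq_chain _ (fun=> 1) _ _ (fun=> isT) chs).
Qed.

Lemma mem_primary_list N n p : n <= N -> is_partition n p ->
  (p \in primary_list N) = all (fun x => is_primary x.2) p && uniq p.
Proof.
move=> le_n /and3P[valid_p sorted_p /eqP sum_p].
have small x : x \in p -> x.1 <= N.
  move=> px; apply: leq_trans le_n; rewrite -sum_p sumnE big_map.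
  by rewrite (big_rem x) //= leq_addr.
apply/mapP/andP => [[s /chains_is_chain chs ->]|[prim_p uniq_p]].
  have ss := @sorted_geq_chain _ (fun=> 1) _ _ (fun=> isT) chs.
  move: chs; rewrite is_chainE => /and3P[_ vs _]; split.
    by rewrite all_map all_rev.
  rewrite map_inj_uniq; last exact: can_inj partK.
  by rewrite rev_uniq; move: ss; rewrite ltn_sorted_uniq_leq => /andP[].
exists (map pos (rev p)); last first.
  by rewrite -map_rev revK -map_comp (eq_map (g := id) posK) map_id.
have pos_gt x : valid_cint x -> 11 <= pos x.
  case: x => m X; rewrite /valid_cint /pos /=.
  by case: X; rewrite /least_integer /=; lia.
apply: mem_chains => //; last first.
  apply/allP => _ /mapP[x + ->]; rewrite mem_rev => /small.
  by have := color_order_lt x.2; rewrite /pos /=; lia.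
rewrite is_chainE rev_sorted_map all_map all_rev; apply/and3P; split.
- have: all valid_cint (rev p) by rewrite all_rev.
  by case: (rev p) => //= x l /andP[/pos_gt].
- by apply: sub_all prim_p => x px; rewrite -[x]posK in px.
(* Weakly decreasing without repetition means strictly decreasing, that is, steps of at least 1. *)
have: sorted gtn (map pos p).
  rewrite gtn_sorted_uniq_geq map_inj_uniq ?uniq_p; last exact: can_inj posK.
  by rewrite sorted_map; apply: sub_sorted sorted_p => x y; rewrite geq_cintE.
by rewrite sorted_map; apply: sub_sorted => x y /=; lia.
Qed.

(** * Both counting functions as counts over explicit lists *)

Lemma num_partitions_count n (P R : pred (seq cint)) (T : seq (seq cint)) :
  uniq T -> (forall p, p \in T -> all valid_cint p && sorted geq_cint p) ->
  (forall p, is_partition n p -> (p \in T) = P p) ->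
  num_partitions n (fun p => P p && R p) =
  count (fun p => (sumn (map fst p) == n) && R p) T.
Proof.
move=> uT validT inT; rewrite -size_filter.
apply: num_partitions_size => [|p]; first exact: filter_uniq.
rewrite mem_filter; have [part_p|npart_p] := boolP (is_partition n p).
  by rewrite inT //; case/and3P: part_p => _ _ ->; rewrite andbC.
apply/negbTE; apply: contra npart_p.
case/andP => /andP[sum_p _] /validT/andP[vp sp].
exact/and3P.
Qed.

Definition letter_count (l : seq color) (p : seq cint) : nat :=
  count (fun x => x.2 \in l) p.

Definition with_A := [:: cA; cAB; cAC; cAD; cABCD].
Definition with_B := [:: cB; cAB; cBC; cBD; cABCD].
Definition with_C := [:: cC; cAC; cBC; cCD; cABCD].
Definition with_D := [:: cD; cAD; cBD; cCD; cABCD].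

Lemma letter_countE l p : uniq l -> letter_count l p = \sum_(X <- l) nu X p.
Proof.
move=> ul; rewrite /letter_count /nu; elim: p => [|x p IH] /=.
  by rewrite big1.
rewrite big_split -IH; congr addn.
rewrite -(count_uniq_mem x.2 ul) -sum1_count big_mkcond /=.
by apply: eq_bigr => X _; rewrite eq_sym; case: eqP.
Qed.

Definition multidegree p : nat * nat * nat * nat :=
  (letter_count with_A p, letter_count with_B p,
   letter_count with_C p, letter_count with_D p).

Lemma multidegreeE p : multidegree p =
  (nu cA p + nu cAB p + nu cAC p + nu cAD p + nu cABCD p,
   nu cB p + nu cAB p + nu cBC p + nu cBD p + nu cABCD p,
   nu cC p + nu cAC p + nu cBC p + nu cCD p + nu cABCD p,
   nu cD p + nu cAD p + nu cBD p + nu cCD p + nu cABCD p).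
Proof.
by rewrite /multidegree !letter_countE // !big_cons big_nil !addn0 !addnA.
Qed.

Lemma multidegree_primary p : all (fun x => is_primary x.2) p ->
  multidegree p = (nu cA p, nu cB p, nu cC p, nu cD p).
Proof.
move=> prim_p; have nu0 X : ~~ is_primary X -> nu X p = 0.
  move=> nX; apply/eqP; rewrite -leqn0 leqNgt -has_count.
  by apply: contra nX => /hasP[x /(allP prim_p) + /eqP <-].
rewrite multidegreeE (nu0 cAB) // (nu0 cAC) // (nu0 cAD) // (nu0 cBC) //.
by rewrite (nu0 cBD) // (nu0 cCD) // (nu0 cABCD) // !addn0.
Qed.

Lemma P6_count N n i j k l : n <= N -> P6 n i j k l =
  count (fun p => (sumn (map fst p) == n) && (multidegree p == (i, j, k, l)))
        (primary_list N).
Proof.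
move=> le_n; rewrite -(num_partitions_count _ (primary_list_uniq N)
  (@primary_list_partition N) (fun p => mem_primary_list le_n)).
apply: eq_card => q; rewrite !inE; congr (_ && _); rewrite -andbA.
have [prim_p|//] := boolP (all _ _); congr (_ && _).
by rewrite multidegree_primary // !xpair_eqE -!andbA.
Qed.

(** For a given [p] only [m X = nu X p] can match, and it solves the four equations exactly when [p]
    has the prescribed multidegree. *)
Lemma sum_nu_pattern (i j k l : nat) p :
  \sum_(m : {ffun color -> 'I_(i + j + k + l).+1} |
        [&& i == m cA + m cAB + m cAC + m cAD + m cABCD,
            j == m cB + m cAB + m cBC + m cBD + m cABCD,
            k == m cC + m cAC + m cBC + m cCD + m cABCD
          & l == m cD + m cAD + m cBD + m cCD + m cABCD])
    ([forall X, nu X p == m X] : nat) = (multidegree p == (i, j, k, l)).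
Proof.
rewrite multidegreeE !xpair_eqE -!andbA.
set M := i + j + k + l; set c := [&& _, _, _ & _].
have [cT|cF] := boolP c; last first.
  rewrite big1 // => m cm; case: forallP => // nu_m; case/negP: cF; rewrite /c.
  by rewrite !(eqP (nu_m _)) !(eq_sym _ i, eq_sym _ j, eq_sym _ k, eq_sym _ l).
(* Every color contains one of the four letters, so [inord] below truncates nothing. *)
have le_nu X : nu X p < M.+1.
  move: cT; rewrite /c /M; case/and4P => /eqP<- /eqP<- /eqP<- /eqP<-.
  by case: X; lia.
pose m0 := [ffun X => inord (nu X p) : 'I_M.+1].
have m0E X : m0 X = nu X p :> nat by rewrite ffunE inordK.
rewrite (bigD1 m0) /=; last first.
  by rewrite !m0E; case/and4P: cT => /eqP-> /eqP-> /eqP-> /eqP->; rewrite !eqxx.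
rewrite (_ : [forall X, _]); last by apply/forallP => X; rewrite m0E.
rewrite big1 // => m /andP[_ m_m0]; case: forallP => // nu_m.
case/eqP: m_m0; apply/ffunP => X; apply: val_inj.
by rewrite /= m0E (eqP (nu_m X)).
Qed.

Lemma G6_count N m1 m2 n i j k l :
  n <= N -> 11 * N.+2 <= m1 -> 11 * N.+2 <= m2 -> G6 n i j k l =
  count (fun p => (sumn (map fst p) == n) && (multidegree p == (i, j, k, l)))
        (type1_list m1 m2).
Proof.
move=> le_n le_m1 le_m2; rewrite /G6.
under eq_bigr => m _ do rewrite /G6_tilde (num_partitions_count _
  (type1_list_uniq m1 m2) (@type1_list_partition m1 m2)
  (fun p => mem_type1_list le_n le_m1 le_m2)) -sum1_count big_mkcond.
rewrite exchange_big -sum1_count [RHS]big_mkcond; apply: eq_bigr => p _ /=.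
case: eqP => _; last by rewrite big1.
rewrite -[RHS]/(nat_of_bool (multidegree p == (i, j, k, l))) -sum_nu_pattern.
by apply: eq_bigr => m _.
Qed.

Import GRing.Theory.
Local Open Scope ring_scope.

(** * The q-series identity *)

Section QSeries.

Context (K : comNzRingType) (N : nat) (q : K) (q_nil : q ^+ N.+1 = 0).

Implicit Types (f g u : {poly K}) (c A B C D : K) (n Q : nat).

Lemma q_nilW n : (N < n)%N -> q ^+ n = 0.
Proof. by move/subnK<-; rewrite exprD q_nil mulr0. Qed.

(* [inv_poch Q] is [1 / (q; q)_Q], [qexp u] is [1 / (u; q)_oo] and [qpoch u] is
   [(- u; q)_oo]; the truncations are exact because [q] is nilpotent. *)
Definition inv_poch Q : K :=
  \prod_(1 <= i < Q.+1) \sum_(j < N.+1) (q ^+ i) ^+ j.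

Lemma inv_poch0 : inv_poch 0 = 1.
Proof. by rewrite /inv_poch big_geq. Qed.

(** The last geometric sum telescopes: times [1 - q^(Q+1)] it gives [1 - q^((Q+1)(N+1)) = 1]. *)
Lemma inv_pochS Q : (1 - q ^+ Q.+1) * inv_poch Q.+1 = inv_poch Q.
Proof.
rewrite /inv_poch big_nat_recr //= mulrCA -[RHS]mulr1; congr (_ * _).
rewrite -[LHS]opprK -mulNr opprB -subrX1 opprB -exprM q_nilW ?subr0 //.
exact: leq_pmull.
Qed.

Definition qexp u : {poly K} := \sum_(Q < N.+1) (inv_poch Q)%:P * u ^+ Q.

(** Compare coefficients of [u^(Q+1)]: [inv_poch Q.+1 - inv_poch Q = q^(Q+1) inv_poch Q.+1]. The
    hypothesis on [u] removes the top term left by the truncation. *)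
Lemma qexpE u : u ^+ N.+1 = 0 -> (1 - u) * qexp u = qexp (q%:P * u).
Proof.
move=> u0; rewrite /qexp mulrBl mul1r mulr_sumr.
under [X in _ - X]eq_bigr => i _ do rewrite mulrCA -exprS.
rewrite big_ord_recl [X in _ - X]big_ord_recr /= u0 mulr0 addr0.
rewrite [RHS]big_ord_recl /= !expr0 -addrA -sumrB; congr (_ + _).
apply: eq_bigr => i _; rewrite /bump /= add1n -mulrBl -polyCB.
rewrite -(inv_pochS i) exprMn -polyC_exp mulrA -polyCM.
by congr (_%:P * _); ring.
Qed.

Lemma qexp0 : qexp 0 = 1.
Proof.
rewrite /qexp big_ord_recl /= expr0 mulr1 inv_poch0 big1 ?addr0 //.
by move=> i _; rewrite expr0n mulr0.
Qed.

Definition qpoch u : {poly K} := \prod_(i < N.+1) (1 + (q ^+ i)%:P * u).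

(** The shift adds a factor at [i = N + 1], which is 1 because [q^(N+1) = 0]. *)
Lemma qpochE u : (1 + u) * qpoch (q%:P * u) = qpoch u.
Proof.
rewrite /qpoch big_ord_recr [RHS]big_ord_recl /= expr0 mul1r.
rewrite [(q ^+ N)%:P * _]mulrA -polyCM -exprSr q_nil mul0r addr0 mulr1.
congr (_ * _).
by apply: eq_bigr => i _; rewrite mulrA -polyCM -exprSr.
Qed.

Lemma qpoch0 : qpoch 0 = 1.
Proof. by rewrite /qpoch big1 // => i _; rewrite mulr0 addr0. Qed.

(** * The dilation [t -> q t] and the functional [theta] *)

Definition dil : {poly K} -> {poly K} := comp_poly (q%:P * 'X).
HB.instance Definition _ := GRing.RMorphism.on dil.

Lemma dilC c : dil c%:P = c%:P.
Proof. exact: comp_polyC. Qed.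

Lemma coef_dil f k : (dil f)`_k = q ^+ k * f`_k.
Proof.
elim/poly_ind: f k => [|f c IH] k; first by rewrite raddf0 !coef0 mulr0.
rewrite rmorphD rmorphM /= dilC {2}/dil comp_polyX mulrCA.
rewrite !coefD !coefC mul_polyC !(coefZ, coefMX).
case: k => [|k] /=; first by rewrite expr0 mulr0 mul1r.
by rewrite IH exprS; ring.
Qed.

Lemma dil_qexp u : dil (qexp u) = qexp (dil u).
Proof.
rewrite rmorph_sum; apply: eq_bigr => i _.
by rewrite rmorphM rmorphXn /= dilC.
Qed.

Lemma dil_qpoch u : dil (qpoch u) = qpoch (dil u).
Proof.
rewrite rmorph_prod; apply: eq_bigr => i _.
by rewrite rmorphD rmorphM /= dilC rmorph1.
Qed.

(* [theta n] is [Phi_(n+1)] in the variable [t = q X] used below. *)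
Definition theta n f : K := \sum_(k < size f) q ^+ ('C(k, 2) + n * k) * f`_k.

Lemma theta_widen m n f : (size f <= m)%N ->
  theta n f = \sum_(k < m) q ^+ ('C(k, 2) + n * k) * f`_k.
Proof.
move=> le_m; rewrite /theta.
rewrite (big_ord_widen _ (fun k => q ^+ ('C(k, 2) + n * k) * f`_k) le_m).
rewrite big_mkcond; apply: eq_bigr => k _; case: ltnP => // le_k.
by rewrite nth_default // mulr0.
Qed.

Lemma thetaD n f g : theta n (f + g) = theta n f + theta n g.
Proof.
pose m := maxn (size f) (size g).
rewrite !(@theta_widen m) ?size_polyD ?leq_max ?leqnn ?orbT // -big_split /=.
by apply: eq_bigr => k _; rewrite coefD mulrDr.
Qed.

Lemma theta_sum n m (F : 'I_m -> {poly K}) :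
  theta n (\sum_i F i) = \sum_i theta n (F i).
Proof.
elim/big_rec2: _ => [|i f c _ <-]; last by rewrite thetaD.
by rewrite /theta size_poly0 big_ord0.
Qed.

Lemma thetaC n c f : theta n (c%:P * f) = c * theta n f.
Proof.
rewrite (@theta_widen (size f)); last by rewrite mul_polyC size_scale_leq.
by rewrite mulr_sumr; apply: eq_bigr => k _; rewrite coefCM mulrCA.
Qed.

(** Rests on [C(k+1, 2) + n (k+1) = n + C(k, 2) + (n+1) k]. *)
Lemma thetaX n f : theta n ('X * f) = q ^+ n * theta n.+1 f.
Proof.
rewrite (@theta_widen (size f).+1).
  rewrite big_ord_recl coefXM mulr0 add0r mulr_sumr.
  apply: eq_bigr => k _; rewrite coefXM /= /bump /= add1n binS bin1.
  by rewrite mulrA -exprD; congr (q ^+ _ * _); lia.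
by rewrite (leq_trans (size_polyMleq _ _)) // size_polyX.
Qed.

Lemma theta_dil n f : theta n (dil f) = theta n.+1 f.
Proof.
rewrite (@theta_widen (size f)).
  apply: eq_bigr => k _; rewrite coef_dil mulrA -exprD.
  by congr (q ^+ _ * _); lia.
by apply/leq_sizeP => j le_j; rewrite coef_dil nth_default // mulr0.
Qed.

Lemma theta_nil n f : (N < n)%N -> theta n f = f`_0.
Proof.
move=> lt_n; rewrite (@theta_widen (size f).+1) // big_ord_recl /=.
rewrite muln0 expr0 mul1r big1 ?addr0 // => k _.
by rewrite q_nilW ?mul0r //= /bump /=; lia.
Qed.

Lemma theta1 n : theta n 1 = 1.
Proof. by rewrite /theta size_poly1 big_ord1 coef1 muln0 expr0 mulr1. Qed.

Lemma dilM f g : dil (f * g) = dil f * dil g. Proof. exact: rmorphM. Qed.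
Lemma dilD f g : dil (f + g) = dil f + dil g. Proof. exact: rmorphD. Qed.
Lemma dil1 : dil 1 = 1. Proof. exact: rmorph1. Qed.

(* The variable [t]. With the extra factor [q] the series [1 / (1 - A t)] is a
   polynomial. *)
Definition qX : {poly K} := q%:P * 'X.

Lemma dil_qX : dil qX = q%:P * qX.
Proof. by rewrite /qX dilM dilC /dil comp_polyX. Qed.

Lemma qX_nil f : (qX * f) ^+ N.+1 = 0.
Proof. by rewrite /qX !exprMn -polyC_exp q_nil !mul0r. Qed.

(** Together with [theta_dil] at [n = 0], it shows that [theta 0] agrees on [qX * f] and
    [q * dil f], so it kills the telescoping difference. *)
Lemma theta_qX n f : theta n (qX * f) = q ^+ n.+1 * theta n.+1 f.
Proof. by rewrite /qX -mulrA thetaC thetaX mulrA -exprS. Qed.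

Lemma qexp_qX f : qexp (q%:P * (qX * f)) = (1 - qX * f) * qexp (qX * f).
Proof. by rewrite qexpE // qX_nil. Qed.

(** The series [h(t)] at [t = qX]. *)
Definition chain_poly A B C D : {poly K} :=
  (qexp (qX * A%:P) * qexp (qX * B%:P) * qexp (qX * C%:P) * qexp (qX * D%:P)) *
  (qpoch (qX * (q * A * B)%:P) * qpoch (qX * (q * A * C)%:P) *
   qpoch (qX * (q * A * D)%:P) * qpoch (qX * (q * B * C)%:P) *
   qpoch (qX * (q * B * D)%:P) * qpoch (qX * (q * C * D)%:P)).

Definition primary_poly A B C D : {poly K} :=
  (1 - qX * A%:P) * (1 - qX * B%:P) * (1 - qX * C%:P) * (1 - qX * D%:P).
Definition secondary_poly A B C D : {poly K} :=
  (1 + qX * (A * B)%:P) * (1 + qX * (A * C)%:P) * (1 + qX * (A * D)%:P) *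
  (1 + qX * (B * C)%:P) * (1 + qX * (B * D)%:P) * (1 + qX * (C * D)%:P).

Lemma dil_linear c : dil (qX * c%:P) = q%:P * (qX * c%:P).
Proof. by rewrite dilM dil_qX dilC mulrA. Qed.

(** Replacing [t] by [q t] in [h] strips the factors [1 / (1 - X t)] and [1 + XY q t]; the latter
    are the dilated factors of [secondary_poly]. This relates consecutive integers. *)
Lemma chain_polyE A B C D :
  primary_poly A B C D * chain_poly A B C D =
  dil (secondary_poly A B C D * chain_poly A B C D).
Proof.
rewrite /primary_poly /secondary_poly /chain_poly.
rewrite !(dil_linear, dilM, dilD, dil1, dil_qexp, dil_qpoch).
rewrite !qexp_qX.
have E a b : (1 + q%:P * (qX * (a * b)%:P)) *
               qpoch (q%:P * (qX * (q * a * b)%:P)) =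
             qpoch (qX * (q * a * b)%:P).
  by rewrite -[RHS]qpochE; congr ((1 + _) * _); rewrite !polyCM; ring.
rewrite -(E A B) -(E A C) -(E A D) -(E B C) -(E B D) -(E C D).
by ring.
Qed.

(* The two summands come from the Type-1 partitions without and with the part
   [A_1], whose quaternary parts have different lower bounds. *)
Definition type1_poly A B C D : {poly K} :=
  let x := (A * B * C * D)%:P in
  qexp (qX * (qX * x)) *
  ((1 - qX * (qX * x)) * (1 - qX * A%:P) * (1 + qX * (qX * (B * C * D)%:P)) +
   qX * A%:P * (1 + qX * (B * C)%:P) * (1 + qX * (B * D)%:P) *
     (1 + qX * (C * D)%:P)) * chain_poly A B C D.

(* The series [R] of the telescoping identity. *)
Definition cert A B C D : {poly K} :=
  A%:P * (qpoch (qX * (B * C)%:P) * qpoch (qX * (B * D)%:P) *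
  qpoch (qX * (C * D)%:P)) * (qpoch (qX * (q * A * B)%:P) *
  qpoch (qX * (q * A * C)%:P) * qpoch (qX * (q * A * D)%:P)) *
  (qexp (qX * A%:P) * qexp (qX * B%:P) * qexp (qX * C%:P) * qexp (qX * D%:P)) *
  qexp (qX * (qX * (A * B * C * D)%:P)).

(** The functional equations bring all Euler products to common arguments; a polynomial identity in
    them remains for [ring]. *)
Lemma type1_poly_cert A B C D :
  type1_poly A B C D - (1 + A * q)%:P * type1_poly (A * q) B C D =
  qX * cert A B C D - q%:P * dil (cert A B C D).
Proof.
have Ep f : qpoch (qX * f) = (1 + qX * f) * qpoch (q%:P * (qX * f)).
  by rewrite qpochE.
rewrite /cert !dilM !(dil_qexp, dil_qpoch) !dil_linear !dilC.
rewrite dilM dil_qX dil_linear.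
(* Dilation multiplies [t^2] by [q^2], so the quaternary product is shifted twice and needs
   [qexp_qX] twice. *)
have -> : q%:P * qX * (q%:P * (qX * (A * B * C * D)%:P)) =
          q%:P * (qX * (q%:P * (qX * (A * B * C * D)%:P))) by ring.
have ex : qX * (q%:P * (qX * (A * B * C * D)%:P)) =
          q%:P * (qX * (qX * (A * B * C * D)%:P)) by ring.
rewrite !qexp_qX ex qexp_qX.
rewrite /type1_poly /chain_poly.
have -> : qX * (qX * (A * q * B * C * D)%:P) =
          q%:P * (qX * (qX * (A * B * C * D)%:P)).
  by rewrite !polyCM; ring.
have -> : qX * (A * q)%:P = q%:P * (qX * A%:P) by rewrite !polyCM; ring.
have Eq c : qX * (q * (A * q) * c)%:P = q%:P * (qX * (q * A * c)%:P).
  by rewrite !polyCM; ring.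
rewrite !Eq !qexp_qX.
have Er a b : q%:P * (qX * (a * b)%:P) = qX * (q * a * b)%:P.
  by rewrite !polyCM; ring.
rewrite (Ep (B * C)%:P) (Ep (B * D)%:P) (Ep (C * D)%:P) !Er.
rewrite (Ep (q * A * B)%:P) (Ep (q * A * C)%:P) (Ep (q * A * D)%:P).
rewrite !Er !(polyCM, polyCD) polyC1.
by ring.
Qed.

Definition weight_prod c : K := \prod_(i < N.+1) (1 + c * q ^+ i.+1).

Lemma theta_type1_poly_dil A B C D :
  theta 0 (type1_poly A B C D) =
  (1 + A * q) * theta 0 (type1_poly (A * q) B C D).
Proof.
rewrite -[type1_poly A B C D](subrK ((1 + A * q)%:P *
  type1_poly (A * q) B C D)).
rewrite type1_poly_cert !thetaD thetaC -mulNr -polyCN thetaC.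
by rewrite theta_qX theta_dil expr1 mulNr addrN add0r.
Qed.

(** With a letter absent the quaternary product is 1 and both brackets equal [1 + BCD t^2], on the
    right as [(1 - B t) + B t (1 + CD t)]. *)
Lemma type1_poly_rot B C D : type1_poly 0 B C D = type1_poly B C D 0.
Proof.
rewrite /type1_poly /chain_poly !(mulr0, mul0r).
rewrite !qexp0 !qpoch0; ring.
Qed.

Lemma theta_type1_poly_rot A B C D :
  theta 0 (type1_poly A B C D) = weight_prod A * theta 0 (type1_poly B C D 0).
Proof.
have E m : theta 0 (type1_poly A B C D) =
    (\prod_(i < m) (1 + A * q ^+ i.+1)) *
    theta 0 (type1_poly (A * q ^+ m) B C D).
  elim: m => [|m ->]; first by rewrite big_ord0 mul1r expr0 mulr1.
  rewrite big_ord_recr /= -[in RHS]mulrA theta_type1_poly_dil exprSr.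
  by rewrite -!mulrA.
(* After [N + 1] iterations the first argument is [A q^(N+1) = 0]. *)
by rewrite (E N.+1) q_nil mulr0 type1_poly_rot.
Qed.

(** Four rotations replace every letter by 0, and [type1_poly] is then 1. *)
Lemma theta_type1_poly A B C D :
  theta 0 (type1_poly A B C D) =
  weight_prod A * weight_prod B * weight_prod C * weight_prod D.
Proof.
rewrite 4!theta_type1_poly_rot /type1_poly /chain_poly !(mulr0, mul0r).
by rewrite !qexp0 !qpoch0 !(mulr1, addr0, subr0) theta1 !mulrA mulr1.
Qed.

Lemma qexp_coef0 u : u`_0 = 0 -> (qexp u)`_0 = 1.
Proof.
rewrite -!horner_coef0 => u0; rewrite /qexp horner_sum big_ord_recl /=.
rewrite expr0 mulr1 hornerC inv_poch0 big1 ?addr0 // => i _.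
by rewrite hornerM horner_exp u0 expr0n mulr0.
Qed.

Lemma qpoch_coef0 u : u`_0 = 0 -> (qpoch u)`_0 = 1.
Proof.
rewrite -!horner_coef0 => u0; rewrite /qpoch horner_prod big1 // => i _.
by rewrite hornerD hornerM u0 mulr0 addr0 hornerC.
Qed.

Lemma qX_coef0 f : (qX * f)`_0 = 0.
Proof. by rewrite /qX -mulrA coefCM coefXM mulr0. Qed.

Lemma chain_poly_coef0 A B C D : (chain_poly A B C D)`_0 = 1.
Proof.
by rewrite /chain_poly !coef0M !qexp_coef0 ?qpoch_coef0 ?qX_coef0 // !mulr1.
Qed.

(* The polynomials [p_X], indexed by [color_order X]. *)
Definition tail_poly A B C D (r : nat) : {poly K} :=
  let e c := 1 - qX * c%:P in
  let E c d := 1 + qX * (c * d)%:P in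
  let pC := e A * e B in
  let pB := E C D * e A in
  let pA := E B C * E B D * E C D in
  nth 0 [:: secondary_poly A B C D; secondary_poly A B C D;
            E A C * E A D * pA; E A D * pA; pA;
            E B C * E B D * pB; E B D * pB; pB; E C D * pC; pC; pC * e C] r.

Lemma tail_poly_coef0 A B C D r : (r < 11)%N -> (tail_poly A B C D r)`_0 = 1.
Proof.
have e f : (1 - qX * f)`_0 = 1 by rewrite coefB qX_coef0 coef1 subr0.
have E f : (1 + qX * f)`_0 = 1 by rewrite coefD qX_coef0 coef1 addr0.
do 11?[case: r => [|r] //] => _; rewrite /tail_poly /secondary_poly /=;
  by rewrite !coef0M !(e, E) !mulr1.
Qed.

(** Closed form of the sum over chains from position [i >= 22]. The integer [n = i %/ 11] calls for
    [Phi_n], hence the [.-1]; the weight shift [s] raises the index. *)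
Definition chain_theta A B C D s i : K :=
  theta ((i %/ 11).-1 + s) (tail_poly A B C D (i %% 11) * chain_poly A B C D).

End QSeries.

(** * Generating functions *)

Section ChainSums.

Context (v : pred nat) (g : nat -> nat) (g_gt0 : forall i, (0 < g i)%N).
Context (K : comNzRingType).

Definition chains_sum (w : nat -> K) m i :=
  \sum_(s <- chains v g m i) \prod_(j <- s) w j.

Lemma chains_sumS w m i : chains_sum w m.+1 i =
  chains_sum w m i.+1 + (if v i then w i * chains_sum w m (i + g i)%N else 0).
Proof.
rewrite /chains_sum /= big_cat /=; congr (_ + _).
case: ifP => _; last by rewrite big_nil.
by rewrite big_map big_distrr; apply: eq_bigr => s _; rewrite big_cons.
Qed.

(** Induction on the fuel, which runs out only at positions [>= I], where the empty chain
    contributes 1. *)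
Lemma chains_sum_eq (w f : nat -> K) i0 I :
  (forall i, (i0 <= i)%N ->
     f i = f i.+1 + (if v i then w i * f (i + g i)%N else 0)) ->
  (forall i, (I <= i)%N -> f i = 1) ->
  forall m i, (i0 <= i)%N -> (I <= i + m)%N -> chains_sum w m i = f i.
Proof.
move=> fS f1; elim=> [|m IH] i le_i0 le_I.
  by rewrite addn0 in le_I; rewrite f1 // /chains_sum big_seq1 big_nil.
have := g_gt0 i; rewrite chains_sumS fS // => gi.
by rewrite !IH //; lia.
Qed.

End ChainSums.

Section GeneratingFunctions.

Context (K : comNzRingType) (N : nat) (q : K) (q_nil : q ^+ N.+1 = 0).
Context (A B C D : K).

Definition color_weight X : K :=
  match X with
  | cABCD => A * B * C * D | cAB => A * B | cAC => A * C | cAD => A * D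
  | cA => A | cBC => B * C | cBD => B * D | cB => B | cCD => C * D
  | cC => C | cD => D
  end.

(* A Type-1 partition with [Q] quaternary parts is weighted with [s = 2 Q]: each
   non-quaternary part raises the bound on every quaternary part by [2]. *)
Definition part_weight s i : K :=
  color_weight (part i).2 * q ^+ ((part i).1 + s).

Lemma chain_thetaE s n r : (r < 11)%N ->
  chain_theta N q A B C D s (n * 11 + r) =
  theta q (n.-1 + s) (tail_poly q A B C D r * chain_poly N q A B C D).
Proof.
move=> lt_r; rewrite /chain_theta divnMDl // modnMDl divn_small //.
by rewrite modn_small // addn0.
Qed.

(** Within one integer it reduces to [T r = T r.+1 + c t T r'] for the tail polynomials, with
    [r' = r] for a primary color and [r' = r + 1] for a secondary one; the factor [t] moves to the
    next integer. *)
Lemma chain_theta_rec s i : (22 <= i)%N ->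
  chain_theta N q A B C D s i = chain_theta N q A B C D s i.+1 +
  (if chain_valid i then
     part_weight s i * chain_theta N q A B C D s (i + chain_step i)%N else 0).
Proof.
move=> le_i; rewrite (divn_eq i 11).
have: (i %% 11 < 11)%N by rewrite ltn_pmod.
have: (2 <= i %/ 11)%N by rewrite leq_divRL.
move: (i %/ 11)%N (i %% 11)%N => {le_i i} n r le_n lt_r.
rewrite /chain_valid /chain_step /part_weight partE //=.
have [m n_m] : exists m, n = m.+1 by exists n.-1; lia.
rewrite n_m in le_n *; clear n_m.
have aux c f : c * q ^+ (m.+1 + s) * theta q (m.+1 + s) f =
  theta q (m + s) (qX q * c%:P * f).
  by rewrite -[qX q * _ * _]mulrA theta_qX thetaC addSn; ring.
pose T r := tail_poly q A B C D r.
have up r1 : (r1 < 11)%N -> chain_theta N q A B C D s (m.+1 * 11 + r1 + 11) =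
  theta q (m.+1 + s) (T r1 * chain_poly N q A B C D).
  by move=> ?; rewrite addnAC -mulSnr chain_thetaE.
have step r1 r2 c : (r1 < 10)%N -> (r2 < 11)%N ->
    T r1 = T r1.+1 + qX q * c%:P * T r2 ->
  chain_theta N q A B C D s (m.+1 * 11 + r1) =
  chain_theta N q A B C D s (m.+1 * 11 + r1).+1 +
  c * q ^+ (m.+1 + s) * chain_theta N q A B C D s (m.+1 * 11 + r2 + 11).
  move=> lt1 lt2 E; rewrite -addnS up // aux !chain_thetaE //; last exact: ltnW.
  by rewrite /T in E *; rewrite E mulrDl thetaD -!mulrA addnC.
(* From the integer 2 on, every non-quaternary color is available. *)
have L X : (X != cABCD) && (least_integer X <= m.+1)%N = (X != cABCD).
  by case: X; rewrite /least_integer //= le_n.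
rewrite L.
(* The quaternary position is skipped by chains; tail polynomials 0 and 1 agree. *)
case: r lt_r => [|r] lt_r /=.
  by rewrite -addnS !chain_thetaE ?addr0.
have sec : (m.+1 * 11 + r.+1 + 12 = m.+1 * 11 + r.+2 + 11)%N by lia.
do 9?[case: r lt_r sec => [|r] lt_r sec].
- rewrite sec (step 1 2 (A * B)) //.
  by rewrite /T /tail_poly /= /secondary_poly !polyCM; ring.
- by rewrite sec (step 2 3 (A * C)) //; rewrite /T /tail_poly /= !polyCM; ring.
- by rewrite sec (step 3 4 (A * D)) //; rewrite /T /tail_poly /= !polyCM; ring.
- by rewrite (step 4 4 A) //; rewrite /T /tail_poly /= !polyCM; ring.
- by rewrite sec (step 5 6 (B * C)) //; rewrite /T /tail_poly /= !polyCM; ring.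
- by rewrite sec (step 6 7 (B * D)) //; rewrite /T /tail_poly /= !polyCM; ring.
- by rewrite (step 7 7 B) //; rewrite /T /tail_poly /= !polyCM; ring.
- by rewrite sec (step 8 9 (C * D)) //; rewrite /T /tail_poly /= !polyCM; ring.
- by rewrite (step 9 9 C) //; rewrite /T /tail_poly /= ?polyCM; ring.
case: r lt_r {sec} => // _ /=.
(* The successor of [D_n] lies at the next integer, and [chain_polyE] brings its integrand back. *)
rewrite (_ : (m.+1 * 11 + 10).+1 = m.+1 * 11 + 0 + 11)%N; last by lia.
rewrite !up // chain_thetaE // aux addSn -theta_dil.
rewrite (_ : T 0%N = secondary_poly q A B C D) // -chain_polyE // -thetaD.
by congr (theta _ _ _); rewrite /T /tail_poly /= /primary_poly; ring.
Qed.

Lemma chain_theta_nil s i : (11 * N.+2 <= i)%N ->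
  chain_theta N q A B C D s i = 1.
Proof.
move=> le_i; rewrite /chain_theta (theta_nil q_nil).
  by rewrite coef0M chain_poly_coef0 mulr1 tail_poly_coef0 // ltn_pmod.
have: (N.+2 <= i %/ 11)%N by rewrite leq_divRL // mulnC.
lia.
Qed.

Lemma chain_sumE s m i : (22 <= i)%N -> (11 * N.+2 <= i + m)%N ->
  chains_sum chain_valid chain_step (part_weight s) m i =
  chain_theta N q A B C D s i.
Proof.
apply: (chains_sum_eq chain_step_gt0) => j; first exact: chain_theta_rec.
exact: chain_theta_nil.
Qed.

(** Classically, subtracting [i, i + 4, i + 8, ...] from [Q] parts leaves a partition into at most
    [Q] parts, counted by [1 / (q; q)_Q]. The proof checks the recurrence in [i] instead. *)
Lemma quaternary_sum m i : (0 < i)%N -> (N < i + m)%N ->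
  chains_sum xpredT (fun=> 4%N) (fun j => A * B * C * D * q ^+ j) m i =
  \sum_(Q < N.+1) (A * B * C * D) ^+ Q * inv_poch N q Q *
    q ^+ (i * Q + 4 * 'C(Q, 2)).
Proof.
set x := A * B * C * D.
pose f j :=
  \sum_(Q < N.+1) x ^+ Q * inv_poch N q Q * q ^+ (j * Q + 4 * 'C(Q, 2)).
rewrite -/(f i) => i_gt0 lt_N.
apply: (@chains_sum_eq _ (fun=> 4%N) _ _ _ f 1 N.+1) => // j; rewrite {}/f /=.
  move=> j_gt0; rewrite big_distrr [X in _ = _ + X]big_ord_recr /=.
  (* The term [Q = N] of the shifted sum would be of order [N + 1] in [x]; its power of [q] exceeds
     [N]. *)
  rewrite [X in _ = _ + (_ + X)](_ : _ = 0); last first.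
    have mulqq c d e1 e2 : x * q ^+ e1 * (c * d * q ^+ e2) =
        x * c * d * q ^+ (e1 + e2) by rewrite exprD; ring.
    by rewrite mulqq (q_nilW q_nil) ?mulr0 //; nia.
  rewrite addr0 [LHS]big_ord_recl [X in _ = X + _]big_ord_recl /= !muln0.
  rewrite -addrA; congr (_ + _).
  rewrite -big_split; apply: eq_bigr => Q _; rewrite /bump /= add1n.
  rewrite -(inv_pochS q_nil Q) binS bin1.
  rewrite (_ : q ^+ (j.+1 * Q.+1 + 4 * ('C(Q, 2) + Q)) =
    q ^+ Q.+1 * q ^+ (j * Q.+1 + 4 * ('C(Q, 2) + Q))); last first.
    by rewrite -exprD; congr (q ^+ _); lia.
  rewrite (_ : q ^+ (j * Q.+1 + 4 * ('C(Q, 2) + Q)) =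
    q ^+ j * q ^+ ((j + 4) * Q + 4 * 'C(Q, 2))); last first.
    by rewrite -exprD; congr (q ^+ _); lia.
  by rewrite [x ^+ Q.+1]exprS; ring.
move=> {}lt_N; rewrite big_ord_recl /= inv_poch0 expr0 muln0 expr0 !mulr1.
rewrite big1 ?addr0 // => Q _; rewrite (q_nilW q_nil) ?mulr0 //.
by rewrite /bump /= add1n; nia.
Qed.

Lemma part_weight_prod s (l : seq nat) :
  \prod_(j <- l) part_weight s j =
  (\prod_(j <- l) part_weight 0 j) * q ^+ (s * size l).
Proof.
elim: l => [|j l IH]; first by rewrite !big_nil muln0 expr0 mulr1.
by rewrite !big_cons IH /part_weight /= mulnS addn0 !exprD; ring.
Qed.

Lemma theta_qX_exp n f :
  theta q 0 (qX q ^+ n * f) = q ^+ 'C(n.+1, 2) * theta q n f.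
Proof.
elim: n f => [|n IH] f; first by rewrite expr0 !mul1r.
by rewrite exprSr -mulrA IH theta_qX mulrA -exprD [in RHS]binS bin1 addnC.
Qed.

(** Chains without [A_1]. Secondary colors are missing at the integer 1, so positions 16 to 21 are
    unrolled by hand: only [B_1], [C_1], [D_1] (18, 20, 21) are valid. *)
Lemma chain_sum_low s m : (11 * N.+2 <= m)%N ->
  chains_sum chain_valid chain_step (part_weight s) (m + 6) 16 =
  theta q s ((1 - qX q * A%:P) * (1 + qX q * (qX q * (B * C * D)%:P)) *
    chain_poly N q A B C D).
Proof.
move=> le_m; rewrite !addnS addn0.
rewrite chains_sumS (_ : chain_valid 16 = false) // addr0.
rewrite chains_sumS (_ : chain_valid 17 = false) // addr0.
rewrite chains_sumS (_ : chain_valid 18 = true) //.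
rewrite [chains_sum _ _ _ _ 19]chains_sumS.
rewrite (_ : chain_valid 19 = false) // addr0.
rewrite [chains_sum _ _ _ _ 20]chains_sumS (_ : chain_valid 20 = true) //.
rewrite [chains_sum _ _ _ _ 21]chains_sumS (_ : chain_valid 21 = true) //.
rewrite (_ : chain_step 18 = 11) // (_ : chain_step 20 = 11) //.
rewrite (_ : chain_step 21 = 11) //.
rewrite !chain_sumE; try lia.
rewrite (chain_thetaE _ 2 (r := 0)) // (chain_thetaE _ 2 (r := 10)) //.
rewrite (chain_thetaE _ 2 (r := 9)) // (chain_thetaE _ 2 (r := 7)) //.
rewrite /part_weight /= -theta_dil -chain_polyE // !add1n.
have aux X f : X * q ^+ s.+1 * theta q s.+1 f = theta q s (qX q * X%:P * f).
  by rewrite -[qX q * _ * _]mulrA theta_qX thetaC; ring.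
rewrite !aux -!thetaD; congr (theta _ _ _).
by rewrite /tail_poly /primary_poly /= !polyCM; ring.
Qed.

(** After [A_1] at 15 the chain resumes at [15 + 11 = 26], the position of [A_2]. *)
Lemma chain_sum_high s m : (11 * N.+2 <= m)%N ->
  A * q ^+ s.+1 * chains_sum chain_valid chain_step (part_weight s) m 26 =
  theta q s (qX q * A%:P * ((1 + qX q * (B * C)%:P) * (1 + qX q * (B * D)%:P) *
    (1 + qX q * (C * D)%:P)) * chain_poly N q A B C D).
Proof.
move=> le_m; rewrite chain_sumE; try lia.
rewrite (chain_thetaE _ 2 (r := 4)) // /tail_poly /= add1n.
by rewrite -[qX q * _ * _ * _]mulrA -[qX q * _ * _]mulrA theta_qX thetaC; ring.
Qed.

(** Split on [A_1] and on the number [Q] of quaternary parts. By [theta_qX_exp], index [2 Q] becomes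
    index 0 with a factor [t^(2Q)], and summing over [Q] builds the Euler product in [ABCD t^2]. *)
Lemma type1_sum m1 m2 : (11 * N.+2 <= m1)%N -> (11 * N.+2 <= m2)%N ->
  \sum_(s <- chains chain_valid chain_step (m1 + 7) 15)
     (\prod_(j <- s) part_weight 0 j) *
     chains_sum xpredT (fun=> 4%N) (fun j => A * B * C * D * q ^+ j) m2
       (quaternary_bound s) =
  theta q 0 (type1_poly N q A B C D).
Proof.
move=> le_m1 le_m2; rewrite !addnS addn0.
have low s : s \in chains chain_valid chain_step m1.+4.+2 16 -> 15 \notin s.
  by move/chains_is_chain => ch; apply/negP => /(mem_is_chain ch).
have split1 (F : seq nat -> K) :
    \sum_(s <- chains chain_valid chain_step m1.+4.+3 15) F s =
    \sum_(s <- chains chain_valid chain_step m1.+4.+2 16) F s +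
    \sum_(s <- chains chain_valid chain_step m1.+4.+2 26) F (15 :: s).
  by rewrite chainsS big_cat big_map.
set x := A * B * C * D.
pose c Q := x ^+ Q * inv_poch N q Q.
pose e Q := (4 * 'C(Q, 2))%N.
have V b : (0 < b)%N ->
    chains_sum xpredT (fun=> 4%N) (fun j => x * q ^+ j) m2 b =
    \sum_(Q < N.+1) c Q * q ^+ (b * Q + e Q).
  by move=> b_gt0; apply: quaternary_sum => //; lia.
(* The bound grows by 2 per non-quaternary part, so [Q] quaternary parts give each such part an
   extra [q^(2Q)]. *)
have sumV (r : seq (seq nat)) k :
    \sum_(s <- r) (\prod_(j <- s) part_weight 0 j) *
       (\sum_(Q < N.+1) c Q * q ^+ ((k + 2 * size s) * Q + e Q)) =
    \sum_(Q < N.+1) c Q * q ^+ (k * Q + e Q) *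
       \sum_(s <- r) \prod_(j <- s) part_weight (2 * Q) j.
  under eq_bigr do rewrite big_distrr.
  rewrite exchange_big; apply: eq_bigr => Q _ /=; rewrite big_distrr /=.
  apply: eq_bigr => s _; rewrite (part_weight_prod (2 * Q)).
  rewrite (_ : ((k + 2 * size s) * Q + e Q = k * Q + e Q + 2 * Q * size s)%N).
    by rewrite exprD; ring.
  lia.
rewrite split1.
under eq_big_seq => s /low/negbTE s15.
  rewrite /quaternary_bound s15 V //; over.
under [X in _ + X]eq_bigr => s _.
  rewrite big_cons /quaternary_bound mem_head V // -mulrA.
  (* [A_1] itself counts in [tau]. *)
  rewrite (_ : 3 + 2 * size (15 :: s) = 5 + 2 * size s)%N; last first.
    by rewrite /=; lia.
  over.
rewrite -big_distrr /= !sumV big_distrr -big_split /=.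
(* Beyond this exponent, [4 Q + e Q] leaves [q^Q], while [5 Q + e Q] leaves [q^(2Q)], which turns
   the weight [A q] of [A_1] into [A q^(2Q+1)]. *)
have binE Q : 'C((2 * Q).+1, 2) = (3 * Q + e Q)%N.
  rewrite /e; elim: Q => // Q IH.
  rewrite (_ : (2 * Q.+1).+1 = (2 * Q).+3); last lia.
  rewrite binS bin1 binS IH bin1 binS bin1; lia.
have lowE s := chain_sum_low s le_m1; rewrite !addnS addn0 in lowE.
have highE s m (le_m : (11 * N.+2 <= m)%N) := chain_sum_high s le_m.
transitivity (\sum_(Q < N.+1) c Q *
    (q ^+ Q * theta q 0 (qX q ^+ (2 * Q) * ((1 - qX q * A%:P) *
       (1 + qX q * (qX q * (B * C * D)%:P)) * chain_poly N q A B C D)) +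
     theta q 0 (qX q ^+ (2 * Q) * (qX q * A%:P * ((1 + qX q * (B * C)%:P) *
       (1 + qX q * (B * D)%:P) * (1 + qX q * (C * D)%:P)) *
       chain_poly N q A B C D)))).
  apply: eq_bigr => Q _.
  rewrite !theta_qX_exp binE -lowE -(highE _ m1.+4.+2); last lia.
  rewrite mulrDr; congr (_ + _).
    move: (c Q) => cQ; rewrite -!mulrA; congr (_ * _).
    by rewrite mulrA -exprD; congr (q ^+ _ * _); lia.
  rewrite -/(chains_sum _ _ _ _ _); move: (chains_sum _ _ _ _ _) => S.
  have E : q ^+ (1 + 0) * q ^+ (5 * Q + e Q) =
           q ^+ (3 * Q + e Q) * q ^+ (2 * Q).+1.
    by rewrite -!exprD; congr (q ^+ _); lia.
  transitivity (c Q * A * S * (q ^+ (1 + 0) * q ^+ (5 * Q + e Q))).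
    by rewrite /part_weight /=; ring.
  by rewrite E; ring.
transitivity (theta q 0 (\sum_(Q < N.+1)
   ((c Q * q ^+ Q)%:P * (qX q ^+ (2 * Q) * ((1 - qX q * A%:P) *
       (1 + qX q * (qX q * (B * C * D)%:P)) * chain_poly N q A B C D)) +
    (c Q)%:P * (qX q ^+ (2 * Q) * (qX q * A%:P * ((1 + qX q * (B * C)%:P) *
       (1 + qX q * (B * D)%:P) * (1 + qX q * (C * D)%:P)) *
       chain_poly N q A B C D))))).
  rewrite theta_sum; apply: eq_bigr => Q _.
  by rewrite thetaD !thetaC mulrDr !mulrA.
congr (theta _ _ _); rewrite /type1_poly -/x.
(* The leftover [q^Q] shifts the Euler product once, whence the factor [1 - ABCD t^2] in the case
   without [A_1]. *)
have qexpE1 : (1 - qX q * (qX q * x%:P)) * qexp N q (qX q * (qX q * x%:P)) =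
    \sum_(Q < N.+1) (c Q * q ^+ Q)%:P * qX q ^+ (2 * Q).
  rewrite -qexp_qX //; apply: eq_bigr => Q _.
  rewrite exprMn !(exprMn _ (qX q)) -!polyC_exp /c mul2n -addnn exprD.
  by rewrite !polyCM; ring.
have qexpE0 : qexp N q (qX q * (qX q * x%:P)) =
    \sum_(Q < N.+1) (c Q)%:P * qX q ^+ (2 * Q).
  apply: eq_bigr => Q _.
  rewrite exprMn !(exprMn _ (qX q)) -!polyC_exp /c mul2n -addnn exprD.
  by rewrite !polyCM; ring.
rewrite big_split /=.
under eq_bigr do rewrite mulrA.
under [X in _ + X]eq_bigr do rewrite mulrA.
by rewrite -!big_distrl /= -qexpE0 -qexpE1; ring.
Qed.

(** With step 1 the positions are chosen independently, so the sum factors; each integer contributes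
    four nontrivial factors. *)
Lemma primary_sum :
  chains_sum (fun i => is_primary (part i).2) (fun=> 1%N) (part_weight 0)
    (N.+1 * 11) 11 =
  weight_prod N q A * weight_prod N q B * weight_prod N q C * weight_prod N q D.
Proof.
set v := fun i => _; set w := part_weight 0.
have step m i : chains_sum v (fun=> 1%N) w m.+1 i =
    (if v i then 1 + w i else 1) * chains_sum v (fun=> 1%N) w m i.+1.
  by rewrite chains_sumS addn1; case: (v i); ring.
rewrite /weight_prod -!big_split /=.
have wE n r : (r < 11)%N ->
    (if v (n * 11 + r)%N then 1 + w (n * 11 + r)%N else 1) =
    let X := nth cABCD all_colors r in
    if is_primary X then 1 + color_weight X * q ^+ n else 1.
  by move=> lt_r; rewrite /v /w /part_weight partE //= addn0.
have level k n : chains_sum v (fun=> 1%N) w (k * 11) (n * 11) =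
    \prod_(i < k) ((1 + A * q ^+ (n + i)) * (1 + B * q ^+ (n + i)) *
                   (1 + C * q ^+ (n + i)) * (1 + D * q ^+ (n + i))).
  elim: k n => [|k IH] n.
    by rewrite big_ord0 /chains_sum big_seq1 big_nil.
  rewrite big_ord_recl addn0.
  under eq_bigr do rewrite lift0 addnS -addSn.
  rewrite -IH (_ : k.+1 * 11 = (k * 11).+4.+4.+3)%N; last by lia.
  rewrite -[X in chains_sum _ _ _ _ X]addn0 11!step -!addnS.
  rewrite !wE //= !mul1r !mulrA; congr (_ * _).
  by rewrite mulSn addnC.
exact: (level N.+1 1%N).
Qed.

End GeneratingFunctions.

(** * Equality of the weighted sums over both lists *)

Section Weights.

Context (K : comNzRingType) (N : nat) (q : K) (q_nil : q ^+ N.+1 = 0).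
Context (A B C D : K).

Definition partition_weight (p : seq cint) : K :=
  \prod_(x <- p) (color_weight A B C D x.2 * q ^+ x.1).

Lemma partition_weightE p : partition_weight p =
  A ^+ letter_count with_A p * B ^+ letter_count with_B p *
  C ^+ letter_count with_C p * D ^+ letter_count with_D p *
  q ^+ sumn (map fst p).
Proof.
rewrite /partition_weight /letter_count.
elim: p => [|[m X] p IH]; first by rewrite big_nil /= !expr0 !mulr1.
rewrite big_cons IH /= !exprD.
by case: X => /=; rewrite ?expr0 ?expr1; ring.
Qed.

Lemma partition_weight_merge s r : partition_weight (merge_parts s r) =
  (\prod_(j <- s) part_weight q A B C D 0 j) *
  \prod_(m <- r) (A * B * C * D * q ^+ m).
Proof.
rewrite /partition_weight /merge_parts (perm_big _ (permEl (perm_sort _ _))) /=.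
rewrite big_cat !big_map /=; congr (_ * _).
by apply: eq_bigr => j _; rewrite /part_weight addn0.
Qed.

(** The seven extra units of fuel cover positions 15 to 21, those at the integer 1. *)
Lemma type1_list_weight :
  \sum_(p <- type1_list (11 * N.+2 + 7) (11 * N.+2)) partition_weight p =
  \sum_(p <- primary_list N) partition_weight p.
Proof.
rewrite big_allpairs_dep /=.
under eq_bigr => s _.
  under eq_bigr do rewrite partition_weight_merge.
  rewrite -big_distrr /= -/(chains_sum _ _ _ _ _).
  over.
rewrite (type1_sum q_nil) // theta_type1_poly // -(primary_sum N) big_map.
apply: eq_bigr => s _; rewrite /partition_weight big_map.
rewrite (perm_big _ (permEl (perm_rev _))) /=.
by apply: eq_bigr => j _; rewrite /part_weight addn0.
Qed.

End Weights.

(** * From weighted sums back to counts *)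

Local Open Scope ring_scope.

Lemma coef_sumCXn (R : nzRingType) (I : Type) (r : seq I) (P : pred I)
    (c : I -> R) (e : I -> nat) n :
  (\sum_(i <- r | P i) (c i)%:P * 'X^(e i))`_n =
  \sum_(i <- r | P i && (e i == n)) c i.
Proof.
rewrite coef_sum big_mkcondr; apply: eq_bigr => i _.
by rewrite coefCM coefXn eq_sym; case: eqP; rewrite ?mulr1 ?mulr0.
Qed.

Lemma coef_in_qpoly_Xn (R : comNzRingType) n (f : {poly R}) i : (i < n.+1)%N ->
  (in_qpoly 'X^(n.+1) f : {poly R})`_i = f`_i.
Proof.
move=> lt_i; rewrite /= mk_monic_Xn /=.
rewrite [in RHS](Pdiv.RingMonic.rdivp_eq (monicXn R n.+1) f).
by rewrite coefD coefMXn lt_i add0r.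
Qed.

(** Take for [q] the class of [X] in [Z[X] / (X^(n+1))]: the coefficient of [X^n] survives the
    quotient, and equal integers give equal counts. *)
Lemma count_eq_of_sum (I : Type) (r1 r2 : seq I) (P : pred I) (e : I -> nat) n :
  (forall (K : comNzRingType) (q : K), q ^+ n.+1 = 0 ->
     \sum_(i <- r1 | P i) q ^+ e i = \sum_(i <- r2 | P i) q ^+ e i) ->
  count (fun i => P i && (e i == n)) r1 = count (fun i => P i && (e i == n)) r2.
Proof.
move=> eq12; pose h : {poly int} := 'X^(n.+1).
have coef_gf r :
    (in_qpoly h (\sum_(i <- r | P i) 1%:P * 'X^(e i)) : {poly int})`_n =
    (count (fun i => P i && (e i == n)) r)%:R.
  by rewrite coef_in_qpoly_Xn // coef_sumCXn -sum1_count natr_sum.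
have q_nil : in_qpoly h 'X ^+ n.+1 = 0.
  rewrite -rmorphXn; apply: val_inj => /=.
  by rewrite mk_monic_Xn Pdiv.RingMonic.rmodpp // monicXn.
have in_sum r : in_qpoly h (\sum_(i <- r | P i) 1%:P * 'X^(e i)) =
    \sum_(i <- r | P i) in_qpoly h 'X ^+ e i.
  rewrite rmorph_sum; apply: eq_bigr => i _.
  by rewrite mul1r rmorphXn.
apply/eqP; rewrite -(Num.Theory.eqr_nat int) -!coef_gf !in_sum.
by rewrite (eq12 _ _ q_nil).
Qed.

(** The letters are eliminated one at a time: over [{poly K}] the letter is set to ['X] and one
    coefficient is read off. Nilpotency of [q] passes to the constant [q%:P]. *)
Lemma count_eq_of_weight (T1 T2 : seq (seq cint)) n i j k l :
  (forall (K : comNzRingType) (q A B C D : K), q ^+ n.+1 = 0 ->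
     \sum_(p <- T1) partition_weight q A B C D p =
     \sum_(p <- T2) partition_weight q A B C D p) ->
  let P p := (sumn (map fst p) == n) && (multidegree p == (i, j, k, l)) in
  count P T1 = count P T2.
Proof.
move=> eqT P; pose e (p : seq cint) := sumn (map fst p).
pose a := letter_count with_A; pose b := letter_count with_B.
pose c := letter_count with_C; pose d := letter_count with_D.
have eqA (K : comNzRingType) (q B C D : K) : q ^+ n.+1 = 0 ->
    \sum_(p <- T1 | a p == i) B ^+ b p * C ^+ c p * D ^+ d p * q ^+ e p =
    \sum_(p <- T2 | a p == i) B ^+ b p * C ^+ c p * D ^+ d p * q ^+ e p.
  move=> q_nil; rewrite -!(coef_sumCXn _ xpredT); congr (polyseq _)`_i.
  have W p : (B ^+ b p * C ^+ c p * D ^+ d p * q ^+ e p)%:P * 'X^(a p) =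
      partition_weight q%:P 'X B%:P C%:P D%:P p.
    by rewrite partition_weightE !polyCM !polyC_exp mulrC !mulrA.
  rewrite !(eq_bigr _ (fun p _ => W p)).
  by apply: eqT; rewrite -polyC_exp q_nil.
have eqB (K : comNzRingType) (q C D : K) : q ^+ n.+1 = 0 ->
    \sum_(p <- T1 | (a p == i) && (b p == j)) C ^+ c p * D ^+ d p * q ^+ e p =
    \sum_(p <- T2 | (a p == i) && (b p == j)) C ^+ c p * D ^+ d p * q ^+ e p.
  move=> q_nil; rewrite -!(coef_sumCXn _ (fun p => a p == i)).
  congr (polyseq _)`_j.
  have W p : (C ^+ c p * D ^+ d p * q ^+ e p)%:P * 'X^(b p) =
      'X^(b p) * C%:P ^+ c p * D%:P ^+ d p * q%:P ^+ e p.
    by rewrite !polyCM !polyC_exp mulrC !mulrA.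
  rewrite !(eq_bigr _ (fun p _ => W p)).
  by apply: eqA; rewrite -polyC_exp q_nil.
have eqC (K : comNzRingType) (q D : K) : q ^+ n.+1 = 0 ->
    \sum_(p <- T1 | (a p == i) && (b p == j) && (c p == k))
       D ^+ d p * q ^+ e p =
    \sum_(p <- T2 | (a p == i) && (b p == j) && (c p == k))
       D ^+ d p * q ^+ e p.
  move=> q_nil; rewrite -!(coef_sumCXn _ (fun p => (a p == i) && (b p == j)));
    congr (polyseq _)`_k.
  have W p : (D ^+ d p * q ^+ e p)%:P * 'X^(c p) =
      'X^(c p) * D%:P ^+ d p * q%:P ^+ e p.
    by rewrite !polyCM !polyC_exp mulrC !mulrA.
  rewrite !(eq_bigr _ (fun p _ => W p)).
  by apply: eqB; rewrite -polyC_exp q_nil.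
have PE p : P p =
    (a p == i) && (b p == j) && (c p == k) && (d p == l) && (e p == n).
  by rewrite /P /multidegree !xpair_eqE andbC.
rewrite !(eq_count PE); apply: count_eq_of_sum => K q q_nil.
rewrite -!(coef_sumCXn _ (fun p => (a p == i) && (b p == j) && (c p == k))).
congr (polyseq _)`_l.
have W p : (q ^+ e p)%:P * 'X^(d p) = 'X^(d p) * q%:P ^+ e p.
  by rewrite !polyC_exp mulrC.
by rewrite !(eq_bigr _ (fun p _ => W p)); apply: eqC; rewrite -polyC_exp q_nil.
Qed.

Theorem theorem6 (n i j k l : nat) : G6 n i j k l = P6 n i j k l.
Proof.
rewrite (@G6_count n (11 * n.+2 + 7) (11 * n.+2)) ?leq_addr //.
rewrite (@P6_count n) //; apply: count_eq_of_weight => K q A B C D q_nil.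
exact: type1_list_weight.
Qed.
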